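(* Let $p/q$ be an irreducible fraction with $0<p/q<1$, let $[a_1,\dots,a_n]$ be a continued fraction expansion of $p/q$, and let $N=a_1+\cdots+a_n-1$. Let $X_{p/q}$ be the cluster variable from the ancestral triangle $A(p/q)$, let $\Gamma_{p/q}$ be the set of all paths in $A(p/q)$, and let $\operatorname{wt}(\gamma)$ be the weight of a path $\gamma$. Then $$X_{p/q}=\frac{D}{x_1x_2\cdots x_N}\sum_{\gamma\in\Gamma_{p/q}}\operatorname{wt}(\gamma),\qquad\text{where } D=\prod_{i=1}^{N}\bigl(\text{the denominator of }\operatorname{wt}(T_i)\bigr).$$ In particular, if $F_{p/q}$ denotes the $F$-polynomial obtained from $X_{p/q}$ (by substituting $1$ for all $x_i$), then $$F_{p/q}=\sum_{\gamma\in\Gamma_{p/q}}\ \prod_{T_i\in S_\gamma}y_i .$$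
   Context: **Continued fractions.** For positive integers $a_1,\dots,a_n$, $[a_1,\dots,a_n]$ denotes $\cfrac{1}{a_1+\cfrac{1}{a_2+\cfrac{1}{\ddots+\cfrac{1}{a_n}}}}$. Every irreducible fraction $p/q$ with $0<p/q<1$ has exactly two expansions, $[a_1,\dots,a_n]=[a_1,\dots,a_n-1,1]$ ($a_n\ge2$). Put $l_k=a_1+\cdots+a_k$ and $N=l_n-1$. **Ancestral triangle $A(p/q)$.** It is the labelled planar triangulated figure obtained by stacking triangles $T_1,T_2,\dots,T_N$ from bottom to top. Start with a horizontal edge with left end labelled $0/1$ and right end labelled $1/1$ (the current edge). Each $T_i$ is glued on top of the current edge, with left end $L$ and right end $R$; its third vertex is labelled by the mediant $(a+c)/(b+d)$ if $L,R$ are labelled $a/b,c/d$. If $T_i$ is a right triangle, the new vertex $M$ is placed on the right boundary above $R$, and the new current edge has left end $L$ and right end $M$. If $T_i$ is a left triangle, $M$ is placed on the left boundary above $L$, and the new current edge has left end $M$ and right end $R$. First $a_1-1$ right triangles are stacked, then $a_2$ left triangles, then $a_3$ right triangles, and so on alternately, finally $a_n$ right triangles if $n$ is odd and $a_n$ left triangles if $n$ is even. The vertex of $T_N$ added last is the top vertex and is labelled $p/q$. The left boundary runs from $p/q$ down to $0/1$, the right boundary from $p/q$ down to $1/1$. **Paths.** A path in $A(p/q)$ is a sequence of edges $\gamma=(e_1,\dots,e_m)$ of $A(p/q)$ (each traversed in a direction) such that: the starting point of $e_i$ is the endpoint of $e_{i-1}$; the starting point of $e_1$ is $p/q$ and the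 endpoint of $e_m$ is $0/1$ or $1/1$; for each $i$ the denominator of the starting point of $e_i$ is greater than that of its endpoint. A path divides $A(p/q)$ into two parts; $S_\gamma$ is the set of triangles $T_i$ lying on the left side of $\gamma$ as drawn, i.e. in the part between $\gamma$ and the left boundary (so $S_\gamma=\emptyset$ if $\gamma$ is the left boundary). **Weights.** With variables $x_i,y_i$ and the convention $x_{l_n}=x_{N+1}=1$, set $\operatorname{wt}(\gamma)=\prod_{T_i\in S_\gamma}\operatorname{wt}(T_i)$, where $\operatorname{wt}(T_1)=y_1x_2$ if $T_1$ is right and $y_1/x_2$ if $T_1$ is left, and for $2\le i\le N$: $\operatorname{wt}(T_i)=y_ix_{i+1}/x_{i-1}$ if $T_i$ is right and $T_{i-1}$ is right; $y_ix_{i-1}x_{i+1}$ if $T_i$ is right and $T_{i-1}$ is left; $y_i/(x_{i-1}x_{i+1})$ if $T_i$ is left and $T_{i-1}$ is right; $y_ix_{i-1}/x_{i+1}$ if $T_i$ is left and $T_{i-1}$ is left. The denominator of $\operatorname{wt}(T_i)$ is the denominator in these expressions ($1$ if there is none). **Cluster variables.** $\operatorname{Trop}(y_1,\dots,y_N)$ is the free abelian (multiplicative) group on $y_1,\dots,y_N$ with addition $\prod y_j^{a_j}\oplus\prod y_j^{b_j}=\prod y_j^{\min(a_j,b_j)}$. Write $[x]_+=\max(x,0)$. A seed is a triple $(\mathbf x,\mathbf y,B)$ with $B=(b_{ij})$ an $N\times N$ skew-symmetrizable matrix, $\mathbf y=(u_1,\dots,u_N)$ elements of $\operatorname{Trop}(y_1,\dots,y_N)$,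 and $\mathbf x=(X_1,\dots,X_N)$ rational functions in the independent variables $x_1,\dots,x_N,y_1,\dots,y_N$. The mutation $\mu_k$ sends it to $(\mathbf x',\mathbf y',B')$ with $b'_{ij}=-b_{ij}$ if $i=k$ or $j=k$, and $b'_{ij}=b_{ij}+\operatorname{sgn}(b_{ik})[b_{ik}b_{kj}]_+$ otherwise; $u'_k=u_k^{-1}$ and $u'_j=u_ju_k^{[b_{kj}]_+}(u_k\oplus1)^{-b_{kj}}$ for $j\ne k$; $X'_k=\dfrac{\prod_iX_i^{[-b_{ik}]_+}+u_k\prod_iX_i^{[b_{ik}]_+}}{(u_k\oplus1)X_k}$ and $X'_j=X_j$ for $j\neq k$. A quiver $Q$ on $\{1,\dots,N\}$ without loops and 2-cycles is identified with the matrix $b_{ij}=Q_{ij}-Q_{ji}$, where $Q_{ij}$ is the number of arrows from $i$ to $j$. **The cluster variable from $A(p/q)$.** Let $Q_0$ be the quiver on $\{1,\dots,N\}$ having, for each $i=1,\dots,N-1$, one arrow from $i+1$ to $i$ if $T_i$ is a right triangle and one arrow from $i$ to $i+1$ if $T_i$ is a left triangle, and no other arrows. Then $X_{p/q}$ is the $N$-th entry of $\mathbf x$ in the seed $\mu_N\circ\mu_{N-1}\circ\cdots\circ\mu_1\bigl((x_1,\dots,x_N),(y_1,\dots,y_N),Q_0\bigr)$. *)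

(* Defs.v *)
From HB Require Import structures.
From mathcomp Require Import all_boot all_order all_algebra.
From mathcomp Require Import mpoly.

Set Implicit Arguments.
Unset Strict Implicit.
Unset Printing Implicit Defensive.

Import Order.TTheory GRing.Theory Num.Theory.
Local Open Scope ring_scope.

(* Indices are 0-based throughout: index i stands for the mathematical index
   i + 1 of a triangle, a variable or a matrix row. *)

Section ContinuedFraction.

(* [a_1, ..., a_n] = 1 / (a_1 + 1 / (a_2 + ... + 1 / a_n)) *)
Definition cfrac (a : seq nat) : rat :=
  foldr (fun (k : nat) (r : rat) => (k%:R + r)^-1) 0 a.

Definition is_expansion (a : seq nat) (p q : nat) : Prop :=
  all (fun k => 0 < k)%N a /\ cfrac a = p%:R / q%:R.

End ContinuedFraction.

Section AncestralTriangle.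

Variable a : seq nat.

Definition ntri : nat := (sumn a).-1.

Fixpoint alternate (d : bool) (s : seq nat) : seq bool :=
  if s is k :: s' then nseq k d ++ alternate (~~ d) s' else [::].

(* true for a right triangle, false for a left triangle *)
Definition kinds : seq bool :=
  if a is a1 :: a' then alternate true (a1.-1 :: a') else [::].

Definition is_right (i : nat) : bool := nth true kinds i.

(* The edge (left end, right end) on which triangle i is glued, starting from
   the edge e; [apex i l r] is the vertex created above the edge (l, r).  It is
   used once with vertices and once with their labels. *)
Fixpoint current_edge (V : Type) (apex : nat -> V -> V -> V) (e : V * V)
    (i : nat) : V * V :=
  if i is j.+1 then
    let: (l, r) := current_edge apex e j in
    if is_right j then (l, apex j l r) else (apex j l r, r)
  else e.

(* Vertices are numbered in order of creation: 0 and 1 are the left and right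
   ends of the initial edge, i.+2 is the vertex added with triangle i. *)
Definition vertex := 'I_ntri.+2.

Definition base (i : nat) : nat * nat :=
  current_edge (fun j _ _ => j.+2) (0, 1)%N i.

(* a label is the pair (numerator, denominator) *)
Definition mediant (u v : nat * nat) : nat * nat :=
  (u.1 + v.1, u.2 + v.2)%N.

Definition base_label (i : nat) : (nat * nat) * (nat * nat) :=
  current_edge (fun _ => mediant) ((0, 1)%N, (1, 1)%N) i.

Definition label (v : nat) : nat * nat :=
  match v with
  | 0 => (0, 1)%N
  | 1 => (1, 1)%N
  | i.+2 => mediant (base_label i).1 (base_label i).2
  end.

Lemma label_base (i : nat) :
  (label (base i).1, label (base i).2) = base_label i.
Proof.
elim: i => // i IH; rewrite /base /base_label /= -/(base i) -/(base_label i).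
case: (base i) IH => l r /=; case E: (base_label i) => [l' r'] [ll lr].
by case: is_right; rewrite /= E /= ?ll ?lr.
Qed.

Definition triangle (i : nat) : {set vertex} :=
  [set v : vertex | (v : nat) \in [:: (base i).1; (base i).2; i.+2]].

Definition is_edge (E : {set vertex}) : bool :=
  (#|E| == 2) && [exists i : 'I_ntri, E \subset triangle i].

(* The left boundary consists of the edges joining the left end of the base to
   the apex, for every left triangle and for the topmost triangle. *)
Definition on_left_boundary (E : {set vertex}) : bool :=
  [exists i : 'I_ntri, (~~ is_right i || (i.+1 == ntri)) &&
     (E == [set v : vertex | (v : nat) \in [:: (base i).1; i.+2]])].

(* a directed edge is a pair (starting point, endpoint) *)
Definition dedge := (vertex * vertex)%type.

Definition uedge (e : dedge) : {set vertex} := [set e.1; e.2].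

(* paths from the vertex labelled p/q *)
Definition is_path (p q : nat) (g : seq dedge) : bool :=
  if g is e :: g' then
    [&& all (fun f => is_edge (uedge f)) g,
        path (fun f f' => f.2 == f'.1) e g',
        label e.1 == (p, q),
        label (last e g').2 \in [:: (0, 1)%N; (1, 1)%N]
      & all (fun f : dedge => (label f.2).2 < (label f.1).2)%N g]
  else false.

(* The bound on the length in [paths] excludes no path. *)
Lemma size_path (p q : nat) (g : seq dedge) :
  is_path p q g -> (size g <= ntri.+2)%N.
Proof.
case: g => // e g /and5P[_ hp _ _ hd].
suff /card_uniqP: uniq [seq f.1 | f <- e :: g].
  by rewrite size_map => <-; rewrite -[X in (_ <= X)%N]card_ord max_card.
pose den (f : dedge) := (label f.1).2.
have hs : sorted (fun m n => n < m)%N [seq den f | f <- e :: g].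
  rewrite /= path_map; elim: g e hp hd => //= f g IH e /andP[/eqP ef hp].
  by case/and3P=> he hf hg; rewrite /den -ef he /= IH //= hf.
have tr : transitive (fun m n => n < m)%N by move=> y x z /[swap]; apply: ltn_trans.
have := sorted_uniq tr ltnn hs.
rewrite (_ : map den _ = map (fun v : vertex => (label v).2) [seq f.1 | f <- e :: g]).
  exact: map_uniq.
by rewrite -map_comp.
Qed.

Definition paths (p q : nat) : {set {bseq ntri.+2 of dedge}} :=
  [set g : {bseq ntri.+2 of dedge} | is_path p q g].

(* E is an edge of A(p/q) that the path g does not traverse *)
Definition open_edge (g : seq dedge) (E : {set vertex}) : bool :=
  is_edge E && (E \notin [seq uedge e | e <- g]).

(* two triangles with a common edge not on g *)
Definition same_side (g : seq dedge) : rel 'I_ntri :=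
  fun i j => [exists E : {set vertex},
    [&& open_edge g E, E \subset triangle i & E \subset triangle j]].

Definition touches_left (g : seq dedge) (i : 'I_ntri) : bool :=
  [exists E : {set vertex},
    [&& open_edge g E, on_left_boundary E & E \subset triangle i]].

(* S_g: the triangles that can be reached from the left boundary without
   crossing g *)
Definition left_part (g : seq dedge) : {set 'I_ntri} :=
  [set i | [exists j, touches_left g j && connect (same_side g) j i]].

End AncestralTriangle.

Section ClusterAlgebra.

Variable N : nat.

(* rational functions in x_1, ..., x_N, y_1, ..., y_N *)
Definition ratfun := {fraction {mpoly rat[N + N]}}.

Definition varx (i : 'I_N) : ratfun := FracField.tofrac 'X_(lshift N i).
Definition vary (i : 'I_N) : ratfun := FracField.tofrac 'X_(rshift N i).

(* Trop(y_1, ..., y_N): the monomial with exponent vector u is represented by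
   u, so that its product is written additively. *)
Definition trop := 'rV[int]_N.

Definition trop_oplus (u v : trop) : trop := \row_j Num.min (u 0 j) (v 0 j).

Definition trop_one : trop := 0.

Definition trop_gen (i : 'I_N) : trop := delta_mx 0 i.

Definition trop_val (u : trop) : ratfun := \prod_j vary j ^ u 0 j.

Definition pos (m : int) : int := Num.max m 0.

Definition skew_symmetrizable (B : 'M[int]_N) : Prop :=
  exists2 d : 'I_N -> int, (forall i, 0 < d i) &
    (forall i j, d i * B i j = - (d j * B j i)).

Record seed := Seed {
  cluster : N.-tuple ratfun;
  coeffs : N.-tuple trop;
  exmat : 'M[int]_N;
  exmat_skew : skew_symmetrizable exmat }.

Definition mut_mx (k : 'I_N) (B : 'M[int]_N) : 'M[int]_N :=
  \matrix_(i, j) (if (i == k) || (j == k) then - B i j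
                  else B i j + Num.sg (B i k) * pos (B i k * B k j)).

Definition mut_coeffs (k : 'I_N) (u : N.-tuple trop) (B : 'M[int]_N) :
    N.-tuple trop :=
  let uk := tnth u k in
  [tuple (if j == k then - uk
          else tnth u j + pos (B k j) *: uk
               + (- B k j) *: trop_oplus uk trop_one) | j < N].

Definition mut_cluster (k : 'I_N) (X : N.-tuple ratfun) (u : N.-tuple trop)
    (B : 'M[int]_N) : N.-tuple ratfun :=
  let uk := tnth u k in
  [tuple (if j == k then
            (\prod_i tnth X i ^ pos (- B i k)
             + trop_val uk * \prod_i tnth X i ^ pos (B i k))
            / (trop_val (trop_oplus uk trop_one) * tnth X k)
          else tnth X j) | j < N].

Lemma mut_mx_skew (k : 'I_N) (B : 'M[int]_N) :
  skew_symmetrizable B -> skew_symmetrizable (mut_mx k B).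
Proof.
case=> d d0 dB; exists d => // i j; rewrite !mxE orbC.
case: ifP => _; first by rewrite !mulrN dB opprK.
rewrite !mulrDr dB opprD; congr (_ + _).
have sgk l : Num.sg (B l k) = - Num.sg (B k l).
  by rewrite -(mul1r (Num.sg (B l k))) -(gtr0_sg (d0 l)) -sgrM dB sgrN sgrM
    (gtr0_sg (d0 k)) mul1r.
have posM (c x : int) : 0 < c -> c * pos x = pos (c * x).
  by move=> c0; rewrite /pos maxr_pMr ?mulr0 // ltW.
have posE (x y : int) : Num.sg x * pos (- (x * y)) = - (Num.sg y * pos (- (x * y))).
  rewrite /pos; case: (ltrP 0 (- (x * y))) => h; last by rewrite !mulr0 oppr0.
  suff -> : Num.sg x = - Num.sg y by rewrite mulNr.
  have := gtr0_sg h; rewrite sgrN sgrM.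
  by case: (sgrP x) => _; case: (sgrP y).
have side l m : d l * (Num.sg (B l k) * pos (B l k * B k m)) =
    - (Num.sg (B k l) * pos (- (d k * (B k l * B k m)))).
  by rewrite mulrCA posM // [d l * _]mulrA dB mulNr -mulrA sgk mulNr.
rewrite !side opprK [B k j * B k i]mulrC -!(mulrN (d k)) -!posM //.
by rewrite mulrCA posE mulrN opprK mulrCA.
Qed.

Definition mutate (s : seed) (k : 'I_N) : seed :=
  Seed (mut_cluster k (cluster s) (coeffs s) (exmat s))
       (mut_coeffs k (coeffs s) (exmat s))
       (mut_mx_skew k (exmat_skew s)).

Definition quiver_mx (Q : 'I_N -> 'I_N -> nat) : 'M[int]_N :=
  \matrix_(i, j) ((Q i j)%:Z - (Q j i)%:Z).

Lemma quiver_mx_skew (Q : 'I_N -> 'I_N -> nat) :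
  skew_symmetrizable (quiver_mx Q).
Proof. by exists (fun=> 1) => // i j; rewrite !mul1r !mxE opprB. Qed.

Definition initial_seed (Q : 'I_N -> 'I_N -> nat) : seed :=
  Seed [tuple varx i | i < N] [tuple trop_gen i | i < N] (quiver_mx_skew Q).

(* substituting 1 for every x_i in a polynomial *)
Definition subst_x1 (P : {mpoly rat[N + N]}) : {mpoly rat[N]} :=
  comp_mpoly [tuple (match split i with inl _ => 1 | inr j => 'X_j end)
             | i < N + N] P.

(* The rational function X can be evaluated at x_1 = ... = x_N = 1, and the
   result is the polynomial F. *)
Definition is_Fpolynomial (X : ratfun) (F : {mpoly rat[N]}) : Prop :=
  exists P Q : {mpoly rat[N + N]},
    [/\ X = FracField.tofrac P / FracField.tofrac Q,
        subst_x1 Q != 0 & subst_x1 P = F * subst_x1 Q].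

Lemma Fpolynomial_uniq (X : ratfun) (F G : {mpoly rat[N]}) :
  is_Fpolynomial X F -> is_Fpolynomial X G -> F = G.
Proof.
case=> P [Q [XE Q1 FE]] [P' [Q' [XE' Q1' GE]]].
have nz0 (T : {mpoly rat[N + N]}) : subst_x1 T != 0 -> FracField.tofrac T != 0.
  by apply: contraNneq => /eqP; rewrite tofrac_eq0 => /eqP ->;
    rewrite /subst_x1 comp_mpoly0.
have /eqP : P * Q' = P' * Q.
  apply/eqP; rewrite -tofrac_eq !tofracM.
  by rewrite -eqr_div ?nz0 // -XE -XE'.
move=> /eqP /(congr1 subst_x1); rewrite /subst_x1 !rmorphM /= -/subst_x1.
rewrite -!/(subst_x1 _) FE GE -!mulrA [subst_x1 Q' * _]mulrC => /mulIf; apply.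
by rewrite mulf_neq0.
Qed.

End ClusterAlgebra.

Section FromAncestralTriangle.

Variable a : seq nat.
Local Notation N := (ntri a).
Local Notation right := (is_right a).

(* number of arrows of Q_0 from i to j *)
Definition quiver0 (i j : 'I_N) : nat :=
  (((i : nat) == j.+1) && right j) + (((j : nat) == i.+1) && ~~ right i).

(* X_{p/q}: the N-th entry of the cluster of mu_N o ... o mu_1 (seed) *)
Definition cluster_var : ratfun N :=
  nth 0 (cluster (foldl (@mutate N) (initial_seed quiver0) (enum 'I_N))) N.-1.

(* x_{i+1} with the convention x_{N+1} = 1 *)
Definition xext (i : nat) : ratfun N :=
  if insub i is Some j then varx j else 1.

Definition wt_num (i : 'I_N) : ratfun N :=
  vary i *
  match (i : nat) with
  | 0 => if right 0 then xext 1 else 1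
  | j.+1 => match right j.+1, right j with
            | true, true => xext j.+2
            | true, false => xext j * xext j.+2
            | false, true => 1
            | false, false => xext j
            end
  end.

Definition wt_den (i : 'I_N) : ratfun N :=
  match (i : nat) with
  | 0 => if right 0 then 1 else xext 1
  | j.+1 => match right j.+1, right j with
            | true, true => xext j
            | true, false => 1
            | false, true => xext j * xext j.+2
            | false, false => xext j.+2
            end
  end.

Definition wt_tri (i : 'I_N) : ratfun N := wt_num i / wt_den i.

Definition wt (g : seq (dedge a)) : ratfun N :=
  \prod_(i in left_part g) wt_tri i.

End FromAncestralTriangle.

(* Main.v *)
Require Import Defs.
From mathcomp Require Import all_boot all_order all_algebra.
From mathcomp Require Import mpoly.
From mathcomp Require Import ring zify.

(** Write [l] and [r] for the left and right ends of the edge on which triangle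
[k] is glued.  A path from the apex of triangle [k] starts with a step to [l] or
with a step to [r].  Below [l] the triangles glued since [l] was created lie to
the right of that step; a step to [r] leaves exactly the triangles
[r - 1, ..., k] on its left.  Hence the path sums [G] satisfy
[G (k + 2) = G l + (prod_(r - 1 <= i <= k) wt i) * G r], with [G = 1] at both
ends of the bottom edge ([path_sumS]).

Multiply [G (k + 2)] by [prod_(i <= k) den i / x i], where [den i] is the
denominator of [wt i], and call the result [H (k + 2)].  Along a fan of triangles
that share an end the factors [den i / x i] telescope ([prod_den]), and so do
the numerators ([prod_num]); what is left is
[x_k * H (k + 2) = c * H l + (prod_(r - 1 <= i <= k) y_i) * c' * H r],
where [x_(k + 1)] is one of [c], [c'] and the other is [1] ([arc_varS]).

This is exactly the exchange relation of the mutation at [k] once the vertices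
before [k] have been mutated: in column [k] of the exchange matrix the only
nonzero entries are [1] in row [r - 2], [-1] in row [l - 2] and the original one
in row [k + 1], and the coefficient at [k] is [prod_(r - 1 <= i <= k) y_i], whose
tropical sum with [1] is [1].  This description is preserved by the mutation at
[k] ([mutatedS]), so the last cluster variable is [H] at the top vertex
([cluster_varE]).

Three points link this to the geometric definitions.  The vertex created last is
the only one labelled [p/q], because the labels follow the continued fraction
and have coprime entries ([label_top]), and denominators grow with the order of
creation.  The edges of decreasing denominator are therefore exactly the steps
from an apex to an end of its base ([is_edge_down]), so that paths can be listed
recursively ([sum_paths]).  The part of the figure left of a path, defined by
connectivity to the left boundary, consists of the triangles that lie beside a
step to a right end ([left_partE]).

The claim on the F-polynomial follows because evaluation at [x = 1] is compatible
with sums and products and sends every denominator to [1] and [wt i] to [y_i]. *)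

Set Implicit Arguments.
Unset Strict Implicit.
Unset Printing Implicit Defensive.

Import Order.TTheory GRing.Theory Num.Theory.
Local Open Scope ring_scope.

(** * The stack of triangles *)

Section Base.

Variable a : seq nat.
Local Notation right := (is_right a).

Definition lft (k : nat) : nat := (base a k).1.
Definition rgt (k : nat) : nat := (base a k).2.

Lemma lftS k : lft k.+1 = if right k then lft k else k.+2.
Proof.
by rewrite /lft /base /= -/(base a k); case: (base a k) => l r; case: is_right.
Qed.

Lemma rgtS k : rgt k.+1 = if right k then k.+2 else rgt k.
Proof.
by rewrite /rgt /base /= -/(base a k); case: (base a k) => l r; case: is_right.
Qed.

Lemma lft_lt k : (lft k < k.+2)%N.
Proof. by elim: k => // k IH; rewrite lftS; case: ifP => // _; apply: ltnW. Qed.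

Lemma rgt_lt k : (rgt k < k.+2)%N.
Proof. by elim: k => // k IH; rewrite rgtS; case: ifP => // _; apply: ltnW. Qed.

Lemma rgt_gt0 k : (0 < rgt k)%N.
Proof. by elim: k => // k IH; rewrite rgtS; case: ifP. Qed.

Lemma lft_neq_rgt k : lft k != rgt k.
Proof.
case: k => // k; rewrite lftS rgtS.
have := lft_lt k; have := rgt_lt k.
case: ifP => _ hr hl; first by rewrite neq_ltn hl.
by rewrite neq_ltn hr orbT.
Qed.

Lemma base_max k : (lft k == k.+1) || (rgt k == k.+1).
Proof. by case: k => // k; rewrite lftS rgtS; case: ifP => _; rewrite eqxx ?orbT. Qed.

(** A left end that is older than triangle [j] and is still the left end below
    triangle [k] has never been replaced in between: every replacement inserts
    the newest vertex, and vertex numbers only grow. *)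
Lemma lft_stable j k : (j <= k)%N -> (lft k < j.+2)%N -> lft j = lft k.
Proof.
elim: k => [|k IH]; first by rewrite leqn0 => /eqP ->.
rewrite leq_eqVlt ltnS => /predU1P[-> //|jk]; rewrite lftS.
case: ifP => _; first exact: IH.
by rewrite !ltnS ltnNge jk.
Qed.

Lemma rgt_stable j k : (j <= k)%N -> (rgt k < j.+2)%N -> rgt j = rgt k.
Proof.
elim: k => [|k IH]; first by rewrite leqn0 => /eqP ->.
rewrite leq_eqVlt ltnS => /predU1P[-> //|jk]; rewrite rgtS.
case: ifP => _; last exact: IH.
by rewrite !ltnS ltnNge jk.
Qed.

(** Only left triangles create vertices on the left boundary. *)
Lemma lft_apex j k : lft k = j.+2 -> right j = false.
Proof.
move=> E; have := lft_lt k; rewrite E !ltnS => jk.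
have := lft_stable jk; rewrite E ltnS leqnn => /(_ isT).
by rewrite lftS; case: ifP => // _ Ej; have := lft_lt j; rewrite Ej ltnn.
Qed.

Lemma rgt_apex j k : rgt k = j.+2 -> right j.
Proof.
move=> E; have := rgt_lt k; rewrite E !ltnS => jk.
have := rgt_stable jk; rewrite E ltnS leqnn => /(_ isT).
by rewrite rgtS; case: ifP => // _ Ej; have := rgt_lt j; rewrite Ej ltnn.
Qed.

Section Rec.
Variables (V : Type) (apex : nat -> V -> V -> V) (e : V * V).

(** A quantity attached to the vertices that is determined recursively from the
    two ends of the base below each apex.  Labels, lists of paths and path sums
    are all of this form. *)
Definition at_vertex (v : nat) : V :=
  match v with
  | 0 => e.1
  | 1 => e.2
  | k.+2 => apex k (current_edge a apex e k).1 (current_edge a apex e k).2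
  end.

Lemma at_vertex_base k :
  current_edge a apex e k = (at_vertex (lft k), at_vertex (rgt k)).
Proof.
elim: k => [|k IH]; first exact: surjective_pairing.
rewrite lftS rgtS /= {1}IH; case: (is_right a k).
  by rewrite [at_vertex k.+2]/= IH.
by rewrite [at_vertex k.+2]/= IH.
Qed.

Lemma at_vertexS k :
  at_vertex k.+2 = apex k (at_vertex (lft k)) (at_vertex (rgt k)).
Proof. by rewrite [LHS]/at_vertex at_vertex_base. Qed.

End Rec.

Lemma labelE v : label a v = at_vertex (fun=> mediant) ((0, 1)%N, (1, 1)%N) v.
Proof. by case: v => [|[|k]]. Qed.

Lemma labelS k : label a k.+2 = mediant (label a (lft k)) (label a (rgt k)).
Proof. by rewrite !labelE at_vertexS. Qed.

Local Notation den v := (label a v).2.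

Lemma den_gt0 v : (0 < den v)%N.
Proof.
have [n] := ubnP v; elim: n v => // n IH [|[|k]] // kn.
by rewrite labelS /= addn_gt0 IH // (leq_trans (lft_lt k)).
Qed.

Lemma den_lft k : (den (lft k) < den k.+2)%N.
Proof. by rewrite labelS /= -[X in (X < _)%N]addn0 ltn_add2l den_gt0. Qed.

Lemma den_rgt k : (den (rgt k) < den k.+2)%N.
Proof. by rewrite labelS /= -[X in (X < _)%N]add0n ltn_add2r den_gt0. Qed.

Lemma den_step k : (den k.+1 < den k.+2)%N.
Proof.
by case/orP: (base_max k) (den_lft k) (den_rgt k) => /eqP ->.
Qed.

(** The newer end of each base is the vertex created just before ([base_max]), so
    the denominators increase strictly from vertex to vertex; only the two ends
    of the bottom edge have equal denominators. *)
Lemma den_mono u v : (u < v)%N -> (1 < v)%N -> (den u < den v)%N.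
Proof.
case: v => [|[|k]] // uk _; elim: k uk => [|k IH].
  by case: u => [|[|]].
by rewrite ltnS leq_eqVlt => /predU1P[->|/IH h]; last apply: (ltn_trans h);
  apply: den_step.
Qed.

Lemma den_gtE u v : (den u < den v)%N = (u < v)%N && (1 < v)%N.
Proof.
apply/idP/andP => [|[]]; last exact: den_mono.
case: (ltnP u v) => [uv|vu].
  by move=> h; split=> //; case: v uv h => [|[|v]] //; case: u.
move=> h; exfalso; move: vu; rewrite leq_eqVlt => /predU1P[E|vu].
  by rewrite E ltnn in h.
have [u1|u1] := ltnP 1 u.
  by have := den_mono vu u1; rewrite ltnNge (ltnW h).
by case: u u1 vu h => [|[|u]] //; case: v.
Qed.

Lemma label_end v : (label a v \in [:: (0, 1)%N; (1, 1)%N]) = (v <= 1)%N.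
Proof.
case: v => [|[|k]] //; rewrite !inE [RHS]/=.
apply/negP => /orP[] /eqP E.
  by have := @den_mono 1 k.+2 isT isT; rewrite E.
by have := @den_mono 1 k.+2 isT isT; rewrite E.
Qed.

End Base.

(** * The label of the top vertex *)

Section TopLabel.

Local Notation vec := (nat * nat)%type.

Definition step_edge (e : vec * vec) (d : bool) : vec * vec :=
  if d then (e.1, mediant e.1 e.2) else (mediant e.1 e.2, e.2).

(** The label of the vertex added by the last letter of [w]: on either side it is
    the mediant of the edge reached just before that letter. *)
Definition last_apex (e : vec * vec) (w : seq bool) : vec :=
  let f := foldl step_edge e (take (size w).-1 w) in mediant f.1 f.2.

Definition lincomb (m : nat) (u : vec) (n : nat) (v : vec) : vec :=
  (m * u.1 + n * v.1, m * u.2 + n * v.2)%N.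

Lemma foldl_step_nseq k d e :
  foldl step_edge e (nseq k d) =
  if d then (e.1, lincomb k e.1 1 e.2) else (lincomb 1 e.1 k e.2, e.2).
Proof.
case: e => [[l1 l2] [r1 r2]]; elim: k l1 l2 r1 r2 => [|k IH] l1 l2 r1 r2.
  by case: d; rewrite /lincomb /= !(mul0n, mul1n, add0n, addn0).
by case: d IH => IH /=; rewrite /step_edge /mediant /= IH /lincomb /=;
  congr (_, _); congr (_, _); lia.
Qed.

Lemma last_apex_cat e w w' : (0 < size w')%N ->
  last_apex e (w ++ w') = last_apex (foldl step_edge e w) w'.
Proof.
move=> w0; rewrite /last_apex size_cat take_cat.
rewrite ifF; last by lia.
by rewrite (_ : _ - _ = (size w').-1)%N ?foldl_cat //; lia.
Qed.

Lemma size_alternate d s : size (alternate d s) = sumn s.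
Proof. by elim: s d => //= k s IH d; rewrite size_cat size_nseq IH. Qed.

Lemma cfrac_ge0 s : 0 <= cfrac s.
Proof. by elim: s => //= k s IH; rewrite invr_ge0 addr_ge0 // ler0n. Qed.

(** With [e.1], [e.2] the ends of the initial edge, a first block of [k] right
    triangles replaces [e.2] by [k e.1 + e.2].  The ratio of the two coefficients
    of the last apex therefore goes from [m' / n'] for the remaining blocks, with
    the roles of the two ends exchanged, to [k + n' / m'], which is one step of
    the continued fraction. *)
Lemma last_apex_alternate s k d e :
  all (fun i => 0 < i)%N s -> (0 < k + sumn s)%N ->
  exists m n, [/\ (0 < n)%N,
    last_apex e (alternate d (k :: s)) =
      (if d then lincomb m e.1 n e.2 else lincomb n e.1 m e.2)
    & m%:R = (k%:R + cfrac s) * n%:R].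
Proof.
elim: s k d e => [|k' s IH] k d e /=.
  rewrite addn0 cats0 => _ k0; exists k, 1%N; split=> //; last first.
    by rewrite addr0 mulr1.
  rewrite /last_apex size_nseq take_nseq ?leq_pred // foldl_step_nseq.
  case: k k0 => // k _; rewrite /mediant /lincomb.
  by case: d => /=; congr (_, _); lia.
case/andP=> k'0 s0 _.
rewrite last_apex_cat; last by rewrite size_cat size_nseq addn_gt0 k'0.
rewrite foldl_step_nseq.
have kp : (0 < k' + sumn s)%N by rewrite addn_gt0 k'0.
set e' := (if d then _ else _).
have [m [n [n0 -> E]]] := IH k' (~~ d) e' s0 kp.
have c0 : 0 < k'%:R + cfrac s by rewrite ltr_wpDr ?cfrac_ge0 // ltr0n.
exists (n + k * m)%N, m; split.
- by rewrite -(ltr0n rat) E mulr_gt0 // ltr0n.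
- by rewrite /e'; case: d {IH e'} => /=; rewrite /lincomb /=; congr (_, _); lia.
- rewrite mulrDl -/(cfrac s) natrD natrM {3}E mulKf ?gt_eqF //.
  by rewrite addrC.
Qed.

Variable a : seq nat.

(** Consecutive Farey fractions have determinant one, and taking mediants
    preserves this. *)
Lemma label_det k :
  ((label a (rgt a k)).1 * (label a (lft a k)).2 =
   (label a (lft a k)).1 * (label a (rgt a k)).2 + 1)%N.
Proof.
elim: k => // k IH; rewrite lftS rgtS.
by case: ifP => _; rewrite labelS /mediant /=; lia.
Qed.

Lemma coprime_label k : coprime (label a k.+2).1 (label a k.+2).2.
Proof.
have := label_det k; rewrite labelS /mediant /=.
move: (label a (lft a k)) (label a (rgt a k)) => [l1 l2] [r1 r2] /= E.
rewrite /coprime -dvdn1.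
set g := gcdn _ _.
have h1 : (g %| l1 * (l2 + r2))%N by rewrite dvdn_mull ?dvdn_gcdr.
rewrite -(dvdn_addr _ h1).
have -> : (l1 * (l2 + r2) + 1 = (l1 + r1) * l2)%N by lia.
by rewrite dvdn_mulr ?dvdn_gcdl.
Qed.

Lemma current_edge_foldl (e : vec * vec) i : (i <= size (kinds a))%N ->
  current_edge a (fun=> mediant) e i = foldl step_edge e (take i (kinds a)).
Proof.
elim: i => [|i IH] ik; first by rewrite take0.
rewrite (take_nth true) // foldl_rcons -IH 1?ltnW //= /step_edge /is_right.
by case: (current_edge _ _ _ i).
Qed.

(** The ends of the bottom edge are (0, 1) and (1, 1), so the last apex
    [m (0, 1) + n (1, 1)] represents [1 / (1 + m / n)]; the added [1] restores
    the triangle missing from the first block.  Both fractions are reduced, so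
    equality of their values is equality of the pairs. *)
Lemma label_top (p q : nat) : coprime p q -> (0 < p < q)%N ->
  is_expansion a p q -> (0 < ntri a)%N /\ label a (ntri a).+1 = (p, q).
Proof.
move=> cpq /andP[p0 pq] [a0 aE].
have q0 : (0 < q)%N by apply: leq_trans pq.
case Da: a a0 aE => [|a1 s] a0 aE; rewrite /= in a0 aE.
  move/eqP: aE; rewrite eq_sym mulf_eq0 invr_eq0 !pnatr_eq0.
  by rewrite (gtn_eqF p0) (gtn_eqF q0).
case/andP: a0 aE => a10 s0 E.
have c0 : 0 < (a1%:R + cfrac s : rat).
  by rewrite ltr_wpDr ?cfrac_ge0 // ltr0n.
have n0 : (0 < a1.-1 + sumn s)%N.
  rewrite lt0n; apply: contraL pq; rewrite addn_eq0 => /andP[/eqP a1E /eqP sE].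
  have {}a1E : a1 = 1%N by lia.
  have {}sE : s = [::] by case: (s) s0 sE => //= b s' /andP[]; lia.
  move: E; rewrite a1E sE /= addr0 invr1 => E1; rewrite -leqNgt.
  rewrite -(ler_nat rat) -[leRHS](@divfK _ q%:R) ?pnatr_eq0 -?lt0n //.
  by rewrite -E1 mul1r.
have NE : ntri a = (a1.-1 + sumn s)%N by rewrite Da /ntri /=; lia.
rewrite -Da NE; split=> //.
have [m [n [n1 T]]] := last_apex_alternate true ((0, 1), (1, 1))%N s0 n0.
move: T; rewrite -[alternate _ _]/(kinds (a1 :: s)) -Da => T mE.
have szk : size (kinds a) = (a1.-1 + sumn s)%N.
  by rewrite Da /kinds size_alternate.
have L : label a (a1.-1 + sumn s).+1 = (n, (m + n)%N).
  case N1: (a1.-1 + sumn s)%N (n0) => [|N'] // _.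
  rewrite [label _ _]/= /base_label current_edge_foldl ?szk ?N1 //.
  by move: T; rewrite /last_apex szk N1 /= => ->; rewrite /lincomb /=; congr (_, _); lia.
rewrite L.
have cop : coprime n (m + n).
  case N1: (a1.-1 + sumn s)%N (n0) L => [|N'] // _ L.
  by have := coprime_label N'; rewrite L.
have pE : (p * (m + n) = n * q)%N.
  apply/eqP; rewrite -(eqr_nat rat) !natrM natrD mE.
  have -> : n%:R * q%:R = (a1%:R + cfrac s) * p%:R * n%:R :> rat.
    have -> : p%:R = (a1%:R + cfrac s)^-1 * q%:R :> rat.
      by rewrite E divfK // pnatr_eq0 -lt0n.
    by rewrite mulVKf ?gt_eqF // mulrC.
  apply/eqP; rewrite -{2}(prednK a10) -natr1; ring.
have d1 : (p %| n)%N by rewrite -(Gauss_dvdl n cpq) -pE dvdn_mulr.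
have d2 : (n %| p)%N by rewrite -(Gauss_dvdl p cop) pE dvdn_mulr.
have En : n = p by apply/eqP; rewrite eqn_dvd d1 d2.
congr (_, _) => //; move/eqP: pE; rewrite En eqn_mul2l => /orP[/eqP p1|/eqP //].
by rewrite p1 in p0.
Qed.

End TopLabel.

(** * Paths and the triangles on their left *)

Section Paths.

Variable a : seq nat.
Local Notation N := (ntri a).
Local Notation lft := (lft a).
Local Notation rgt := (rgt a).
Implicit Types (e f : dedge a) (g : seq (dedge a)) (E : {set vertex a}).

Lemma in_triangle (i : nat) (v : vertex a) :
  (v \in triangle a i) = [|| (v : nat) == lft i, (v : nat) == rgt i | (v : nat) == i.+2].
Proof. by rewrite !inE. Qed.

Definition down e : bool :=
  (1 < e.1)%N && ((e.2 : nat) \in [:: lft e.1.-2; rgt e.1.-2]).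

Lemma down_lt e : down e -> (e.2 < e.1)%N.
Proof.
rewrite /down; case: (nat_of_ord e.1) => [|[|k]] //=.
by rewrite !inE => /orP[]/eqP ->; rewrite ?lft_lt ?rgt_lt.
Qed.

(** An edge belongs to some triangle; if it is the base of that triangle, then
    it was created, as a side, by the previous one.  So each edge other than the
    bottom one joins an apex to an end of its own base, and the direction of
    decreasing denominator is from the apex down. *)
Lemma is_edge_down e :
  is_edge (uedge e) && ((label a e.2).2 < (label a e.1).2)%N = down e.
Proof.
case: e => u v; rewrite /uedge /down den_gtE /=.
apply/idP/idP => [/and3P[/andP[_ /existsP[i]]]|/andP[u1 vu]].
  rewrite subUset !sub1set !in_triangle => /andP[ui vi] vu u1; rewrite u1 /=.
  rewrite !inE; case/or3P: ui => [||/eqP ui]; last first.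
  - by rewrite ui /=; case/or3P: vi => /eqP vi; rewrite ?vi ?eqxx ?orbT //; lia.
  - case: (nat_of_ord i) vi => [|j]; rewrite ?lftS ?rgtS.
      by move=> _ /eqP uE; rewrite uE in u1.
    have := lft_lt a j; have := rgt_lt a j.
    case: ifP => _ hr hl vi /eqP ui; rewrite ui /= in vu *.
      by case/or3P: vi => /eqP vi; rewrite ?vi ?eqxx ?orbT //; lia.
    by exfalso; case/or3P: vi => /eqP vi; lia.
  - case: (nat_of_ord i) vi => [|j]; rewrite ?lftS ?rgtS.
      by move=> _ /eqP uE; rewrite uE in u1.
    have := lft_lt a j; have := rgt_lt a j.
    case: ifP => _ hr hl vi /eqP ui; rewrite ui /= in vu *.
      by exfalso; case/or3P: vi => /eqP vi; lia.
    by case/or3P: vi => /eqP vi; rewrite ?vi ?eqxx ?orbT //; lia.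
have lt : (v < u)%N by apply: (@down_lt (u, v)); rewrite /down u1.
rewrite lt u1 !andbT /is_edge cards2; apply/andP; split.
  by rewrite -(inj_eq val_inj) neq_ltn lt orbT.
have uN : (u.-2 < N)%N by have := ltn_ord u; lia.
apply/existsP; exists (Ordinal uN); rewrite subUset !sub1set !in_triangle /=.
apply/andP; split; first by apply/or3P/Or33/eqP; lia.
by move: vu; rewrite !inE => /orP[]->; rewrite ?orbT.
Qed.

Fixpoint walk (v : nat) g : bool :=
  if g is e :: g' then [&& (e.1 : nat) == v, down e & walk e.2 g'] else (v <= 1)%N.

Lemma walk_cons v e g :
  walk v (e :: g) =
  [&& all (fun f => is_edge (uedge f)) (e :: g),
      path (fun f f' : dedge a => f.2 == f'.1) e g, (e.1 : nat) == v,
      label a (last e g).2 \in [:: (0, 1)%N; (1, 1)%N]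
    & all (fun f : dedge a => (label a f.2).2 < (label a f.1).2)%N (e :: g)].
Proof.
elim: g e v => [|f g IH] e v.
  rewrite /= label_end -is_edge_down !andbT.
  by case: (is_edge _); case: (_ == _); case: (_ < _)%N; case: (_ <= 1)%N.
have := IH f e.2; rewrite [walk v _]/= [walk e.2 _]/= => ->.
rewrite -is_edge_down /= (eq_sym e.2) -(inj_eq val_inj) /=.
(* The two sides are conjunctions of the same ten facts. *)
move: (is_edge _) (is_edge _) (_ < _)%N (_ < _)%N (path _ _ _) (_ \in _) => b1 b2 b3 b4 b5 b6.
move: (all _ _) (all _ _) (_ == _) (_ == _) => b7 b8 b9 b0.
by case: b1; case: b2; case: b3; case: b4; case: b5; case: b6; case: b7; case: b8;
  case: b9; case: b0.
Qed.

Lemma is_path_walk p q g :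
  (0 < N)%N -> label a N.+1 = (p, q) -> is_path p q g = walk N.+1 g.
Proof.
move=> N0 top; case: g => [|e g]; first by rewrite /= ltnS leqNgt N0.
rewrite walk_cons /is_path.
suff -> : (label a e.1 == (p, q)) = ((e.1 : nat) == N.+1) by [].
apply/eqP/eqP => [|->//]; rewrite -top => lE.
have := ltn_ord e.1; rewrite ltnS leq_eqVlt => /orP[/eqP //|lt].
by have := den_mono a lt; rewrite lE ltnn => /(_ N0).
Qed.

(** A path descends past [i.+2], the apex of triangle [i], in exactly one step;
    the triangle lies beside that step. *)
Definition covers e (i : nat) : bool := (e.2 < i.+2 <= e.1)%N.
Definition right_step e : bool := (e.2 : nat) == rgt e.1.-2.
(** The step beside triangle [i] goes down to a right end, which puts the
    triangle on its left. *)
Definition left_of g (i : nat) : bool :=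
  has (fun e => covers e i && right_step e) g.

Lemma walk_down v g e : walk v g -> e \in g -> down e.
Proof.
elim: g v => //= f g IH v /and3P[_ df wg]; rewrite inE => /predU1P[->//|].
exact: IH wg.
Qed.

Lemma walk_start_le v g e : walk v g -> e \in g -> (e.1 <= v)%N.
Proof.
elim: g v => //= f g IH v /and3P[/eqP <- df wg]; rewrite inE => /predU1P[->//|eg].
exact: leq_trans (IH _ wg eg) (ltnW (down_lt df)).
Qed.

Lemma cover_exists v g i : walk v g -> (i.+2 <= v)%N ->
  exists2 e : dedge a, e \in g & covers e i.
Proof.
elim: g v => [|f g IH] v /=; first by case: v => [|[|v]].
case/and3P=> /eqP <- df wg iv; have [h|h] := ltnP f.2 i.+2.
  by exists f; rewrite ?mem_head // /covers h.
by have [e eg ce] := IH _ wg h; exists e => //; rewrite inE eg orbT.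
Qed.

Lemma cover_uniq v g i e f : walk v g -> e \in g -> f \in g ->
  covers e i -> covers f i -> e = f.
Proof.
elim: g v => //= h g IH v /and3P[_ _ wg]; rewrite !inE.
case/predU1P=> [->|eg]; case/predU1P=> [->|fg] //; last exact: IH wg eg fg.
  have := walk_start_le wg fg => l /andP[h1 h2] /andP[h3 h4].
  by have := leq_trans (leq_trans h4 l) (ltnSE h1); rewrite ltnn.
have := walk_start_le wg eg => l /andP[h1 h2] /andP[h3 h4].
by have := leq_trans (leq_trans h2 l) (ltnSE h3); rewrite ltnn.
Qed.

Lemma left_ofE v g i e : walk v g -> e \in g -> covers e i ->
  left_of g i = right_step e.
Proof.
move=> wg eg ce; apply/hasP/idP => [[f fg /andP[cf rf]]|re].
  by rewrite (cover_uniq wg eg fg ce cf).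
by exists e; rewrite // ce.
Qed.

(** The two steps at an inner vertex are beside the triangle that created it and
    the next one; [next_edge] and [prev_edge] pass from either to the other. *)
Lemma next_edge v g e i : walk v g -> e \in g -> (e.2 : nat) = i.+2 ->
  exists f : dedge a, [/\ f \in g, covers f i & (f.1 : nat) = i.+2].
Proof.
move=> wg eg e2; have e12 := down_lt (walk_down wg eg).
have iv : (i.+2 <= v)%N by apply: leq_trans (walk_start_le wg eg); lia.
have [f fg cf] := cover_exists wg iv; exists f; split=> //.
move: (cf) => /andP[f2]; rewrite leq_eqVlt => /predU1P[//|f1]; exfalso.
have E : e = f.
  by apply: (@cover_uniq _ _ i.+1 _ _ wg eg fg); rewrite /covers; lia.
by move: f2; rewrite -E e2 ltnn.
Qed.

Lemma prev_edge v g e i : walk v g -> e \in g -> (e.1 : nat) = i.+2 ->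
  (i.+2 < v)%N -> exists f : dedge a, [/\ f \in g, covers f i.+1 & (f.2 : nat) = i.+2].
Proof.
move=> wg eg e1 iv; have [f fg cf] := cover_exists wg iv; exists f; split=> //.
have e12 := down_lt (walk_down wg eg).
move: (cf) => /andP[]; rewrite ltnS leq_eqVlt => /predU1P[//|f2 f1]; exfalso.
have E : e = f.
  by apply: (@cover_uniq _ _ i _ _ wg eg fg); rewrite /covers; lia.
by move: f1; rewrite -E e1 ltnn.
Qed.

Definition base_edge (j : nat) : {set vertex a} :=
  [set v : vertex a | ((v : nat) == lft j) || ((v : nat) == rgt j)].

Lemma card2_triangle E (j : nat) : #|E| == 2 -> E \subset triangle a j ->
  (forall v, v \in E -> (v < j.+2)%N) -> E = base_edge j.
Proof.
move=> /cards2P[x [y [xy ->]]] /subsetP sE ltE.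
have hx : ((x : nat) == lft j) || ((x : nat) == rgt j).
  have := sE x; rewrite !inE eqxx => /(_ isT).
  have := ltE x; rewrite !inE eqxx => /(_ isT) lt.
  by case/or3P => h; rewrite ?h ?orbT //; lia.
have hy : ((y : nat) == lft j) || ((y : nat) == rgt j).
  have := sE y; rewrite !inE eqxx orbT => /(_ isT).
  have := ltE y; rewrite !inE eqxx orbT => /(_ isT) lt.
  by case/or3P => h; rewrite ?h ?orbT //; lia.
apply/setP => v; rewrite !inE -!(inj_eq val_inj) /=.
by move: xy; rewrite -(inj_eq val_inj) /=; lia.
Qed.

(** The triangles form a strip: an edge of both [i] and [j], with [i < j], avoids
    the apex of [j], so it is the base of [j]; this contains vertex [j.+1], which
    a triangle before [j.-1] does not have. *)
Lemma shared_edge E (i j : 'I_N) : #|E| == 2 -> E \subset triangle a i ->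
  E \subset triangle a j -> (i < j)%N -> (j : nat) = i.+1 /\ E = base_edge j.
Proof.
move=> cE si sj ij.
have lti v : v \in E -> (v <= i.+2)%N.
  move=> /(subsetP si); rewrite in_triangle.
  by case/or3P => /eqP -> //; rewrite ltnW ?lft_lt ?rgt_lt.
have Ej : E = base_edge j.
  by apply: card2_triangle => // v /lti h; apply: leq_ltn_trans h _; rewrite !ltnS.
split=> //; apply/eqP; rewrite eqn_leq ij andbT.
have jN : (j.+1 < N.+2)%N by have := ltn_ord j; lia.
suff : Ordinal jN \in E by move/lti; rewrite /= ltnS.
by rewrite Ej inE /= !(eq_sym j.+1) base_max.
Qed.

Lemma base_edgeS_right j : is_right a j ->
  base_edge j.+1 = [set v : vertex a | ((v : nat) == lft j) || ((v : nat) == j.+2)].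
Proof. by move=> rj; apply/setP => v; rewrite !inE lftS rgtS rj. Qed.

Lemma base_edgeS_left j : ~~ is_right a j ->
  base_edge j.+1 = [set v : vertex a | ((v : nat) == j.+2) || ((v : nat) == rgt j)].
Proof. by move=> /negPf rj; apply/setP => v; rewrite !inE lftS rgtS rj. Qed.

Lemma uedgeE e : uedge e = [set v : vertex a | ((v : nat) == e.1) || ((v : nat) == e.2)].
Proof. by apply/setP => v; rewrite !inE -!(inj_eq val_inj). Qed.

Section Walk.

Variable g : seq (dedge a).
Hypothesis wg : walk N.+1 g.

(** Either one step of the path lies beside both triangles, or the path passes
    through the apex of the lower one.  In the second case the next step goes
    down along one side of the lower triangle; the shared edge, being open, is
    the other side, and the type of the triangle decides which side that is. *)
Lemma left_of_next (i j : 'I_N) E : open_edge g E -> E \subset triangle a i ->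
  E \subset triangle a j -> (i < j)%N -> left_of g i = left_of g j.
Proof.
case/andP=> /andP[cE _] oE si sj ij.
have [jE EE] := shared_edge cE si sj ij; rewrite jE.
have ltN : (i.+3 <= N.+1)%N by rewrite -jE; have := ltn_ord j; lia.
have [e eg ce] := cover_exists wg ltN; rewrite (left_ofE wg eg ce).
case/andP: ce; rewrite ltnS leq_eqVlt => /predU1P[e2 e1|e2 e1]; last first.
  by apply: (left_ofE wg eg); rewrite /covers e2 ltnW.
have [f [fg cf f1]] := next_edge wg eg e2; rewrite (left_ofE wg fg cf).
have /andP[_] := walk_down wg fg; rewrite f1 /right_step /= e2 f1 !inE /=.
have /andP[_] := walk_down wg eg; rewrite e2 !inE.
have uf : uedge f <> E by move=> ufE; case/negP: oE; rewrite -ufE map_f.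
have [ri|li] := boolP (is_right a i).
  have -> : (i.+2 == lft e.1.-2) = false.
    by apply/eqP => /esym /lft_apex; rewrite ri.
  move=> /= -> /orP[/eqP f2|-> //]; case: uf; rewrite EE jE base_edgeS_right //.
  by rewrite uedgeE f1 f2; apply/setP => v; rewrite !inE orbC.
have -> : (i.+2 == rgt e.1.-2) = false.
  by apply/eqP => /esym /rgt_apex; rewrite (negPf li).
move=> _ _; apply/negP => /eqP f2; case: uf; rewrite EE jE base_edgeS_left //.
by rewrite uedgeE f1 f2; apply/setP => v; rewrite !inE.
Qed.

Lemma left_of_same_side (i j : 'I_N) : same_side g i j -> left_of g i = left_of g j.
Proof.
case/existsP=> E /and3P[oE si sj]; case: (ltngtP i j) => [ij|ij|/val_inj -> //].
  exact: left_of_next oE si sj ij.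
by apply/esym; apply: left_of_next oE sj si ij.
Qed.

(** An open edge of triangle [i] on the left boundary ends at the apex of [i].
    A step to a left end beside the triangle would either be that edge, which is
    open, or come from above and reach a left end that triangle [i] has already
    replaced. *)
Lemma touches_left_of (i : 'I_N) : touches_left g i -> left_of g i.
Proof.
case/existsP=> E /and3P[/andP[/andP[cE _] oE] /existsP[i' /andP[bi /eqP EE]] si].
have si' : E \subset triangle a i'.
  by apply/subsetP => v; rewrite EE in_triangle !inE => /orP[]->; rewrite ?orbT.
have iN : (i'.+2 < N.+2)%N by rewrite !ltnS.
have ii : i' = i.
  have apx : Ordinal iN \in triangle a i.
    by apply: (subsetP si); rewrite EE !inE eqxx orbT.
  case: (ltngtP i' i) => [lt|lt|/val_inj //]; last first.
    move: apx; rewrite in_triangle /=.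
    by have := lft_lt a i; have := rgt_lt a i; lia.
  have [iE Ei] := shared_edge cE si' si lt.
  have li : ~~ is_right a i'.
    by case/orP: bi => // /eqP; rewrite -iE => h; have := ltn_ord i; rewrite h ltnn.
  have rN : (rgt i' < N.+2)%N by apply: ltn_trans (rgt_lt a i') _.
  have : Ordinal rN \in E by rewrite Ei iE base_edgeS_left // inE eqxx orbT.
  rewrite EE !inE /= eq_sym (negPf (lft_neq_rgt _ _)) /=.
  by have := rgt_lt a i'; lia.
move: i' ii => _ -> in bi EE si' iN *.
have [e eg ce] := cover_exists wg (ltn_ord i : i.+2 <= N.+1)%N.
rewrite (left_ofE wg eg ce) /right_step.
have /andP[_] := walk_down wg eg; rewrite !inE => /orP[/eqP e2|//].
case/andP: ce => e2i; rewrite leq_eqVlt => /predU1P[e1|e1].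
  rewrite -e1 /= in e2; case/negP: oE; apply/mapP; exists e => //.
  by rewrite EE uedgeE -e1 e2; apply/setP => v; rewrite !inE orbC.
case/orP: bi => [li|/eqP iN1]; last first.
  by have := leq_trans e1 (ltnSE (ltn_ord e.1)); rewrite ltnS; move: iN1; lia.
have : lft i.+1 = lft e.1.-2.
  by apply: lft_stable; rewrite -?e2; lia.
by rewrite lftS (negPf li) -e2 => h; rewrite h ltnn in e2i.
Qed.

(** Climbing from a triangle on the left of the path: if it is a left triangle
    or the topmost one, then its left side is an open boundary edge.  Otherwise
    its apex is on the right boundary, and the path visits it, as the step beside
    the triangle ends at an older right end.  Then the left side is the open edge
    shared with the next triangle, which is on the left as well. *)
Lemma left_of_reach (i : 'I_N) : left_of g i ->
  exists2 j, touches_left g j & connect (same_side g) j i.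
Proof.
have [m] := ubnP (N - i); elim: m i => // m IH i im li.
have [e eg /andP[ce re]] : exists2 e : dedge a, e \in g & covers e i && right_step e.
  exact/hasP.
have iN : (i.+2 < N.+2)%N by rewrite !ltnS.
have lN : (lft i < N.+2)%N by apply: ltn_trans (lft_lt a i) _.
have e2i : (e.2 < i.+2)%N by case/andP: ce.
have e2r : rgt i = e.2.
  by rewrite (eqP re); apply: rgt_stable; rewrite -?(eqP re) //; case/andP: ce; lia.
have notE f : f \in g -> [set Ordinal lN; Ordinal iN] <> uedge f.
  move=> fg /setP uE; have fd := walk_down wg fg; have flt := down_lt fd.
  have il := lft_lt a i.
  have := uE (Ordinal lN); have := uE (Ordinal iN).
  rewrite uedgeE !inE -!(inj_eq val_inj) /= !eqxx orbT /=.
  move=> /esym h1 /esym h2.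
  have f1 : (f.1 : nat) = i.+2 by lia.
  have f2 : (f.2 : nat) = lft i by lia.
  have fi : covers f i by rewrite /covers f1 f2 il leqnn.
  move: e2r; rewrite -(cover_uniq wg fg eg fi ce) f2 => /eqP.
  by rewrite eq_sym (negPf (lft_neq_rgt _ _)).
have openE (E : {set vertex a}) : E = [set Ordinal lN; Ordinal iN] ->
    open_edge g E.
  move=> EE; rewrite /open_edge /is_edge EE cards2; apply/andP; split.
    apply/andP; split.
      by rewrite -(inj_eq val_inj) /= neq_ltn lft_lt.
    apply/existsP; exists i; rewrite subUset !sub1set !in_triangle /=.
    by rewrite !eqxx !orbT.
  by apply/mapP => -[f /notE].
have E0 : [set v : vertex a | (v : nat) \in [:: lft i; i.+2]] = [set Ordinal lN; Ordinal iN].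
  by apply/setP => v; rewrite !inE -!(inj_eq val_inj).
have [bi|] := boolP (~~ is_right a i || (i.+1 == N)).
  exists i => //; apply/existsP; exists [set v : vertex a | (v : nat) \in [:: lft i; i.+2]].
  rewrite openE //=; apply/andP; split.
    by apply/existsP; exists i; rewrite bi /= eqxx.
  by rewrite E0 subUset !sub1set !in_triangle /= !eqxx !orbT.
rewrite negb_or negbK => /andP[ri iN1].
have i1 : (i.+1 < N)%N by rewrite ltn_neqAle iN1 ltn_ord.
have e1 : (e.1 : nat) = i.+2.
  case/andP: ce => _; rewrite leq_eqVlt => /predU1P[-> //|e1].
  have : rgt i.+1 = rgt e.1.-2.
    by apply: rgt_stable; rewrite -?(eqP re); lia.
  by rewrite rgtS ri -(eqP re); lia.
have [f [fg cf f2]] := prev_edge wg eg e1 (i1 : i.+2 < N.+1)%N.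
have rf : right_step f.
  have /andP[_] := walk_down wg fg; rewrite !inE => /orP[/eqP|//].
  by rewrite f2 => /esym /lft_apex; rewrite ri.
have [j tj cj] : exists2 j, touches_left g j & connect (same_side g) j (Ordinal i1).
  by apply: IH => /=; [lia | apply/hasP; exists f; rewrite //= cf].
exists j => //; apply: connect_trans cj (connect1 _).
apply/existsP; exists [set Ordinal lN; Ordinal iN]; rewrite openE //=.
by rewrite !subUset !sub1set !in_triangle /= lftS rgtS ri !eqxx !orbT.
Qed.

Lemma left_partE : left_part g = [set i : 'I_N | left_of g i].
Proof.
apply/setP => i; rewrite !inE; apply/existsP/idP => [[j /andP[tj]]|].
  case/connectP=> s hs ->; have {tj} := touches_left_of tj.
  elim: s j hs => //= k s IH j /andP[jk hs] h.
  by apply: IH hs _; rewrite -(left_of_same_side jk).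
by case/left_of_reach=> j tj cj; exists j; rewrite tj.
Qed.

End Walk.

End Paths.

(** * The sum over all paths *)

Section PathSum.

Variable a : seq nat.
Local Notation N := (ntri a).
Local Notation lft := (lft a).
Local Notation rgt := (rgt a).
Implicit Types (e f : dedge a) (g : seq (dedge a)).

Definition descents : nat -> seq (seq (dedge a)) :=
  at_vertex a (fun k gl gr =>
    map (cons (inord k.+2, inord (lft k))) gl ++
    map (cons (inord k.+2, inord (rgt k))) gr) ([:: [::]], [:: [::]]).

Lemma descentsS k : descents k.+2 =
  map (cons (inord k.+2, inord (lft k))) (descents (lft k)) ++
  map (cons (inord k.+2, inord (rgt k))) (descents (rgt k)).
Proof. exact: at_vertexS. Qed.

Lemma vertex_ind (P : nat -> Prop) : P 0 -> P 1 ->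
  (forall k, P (lft k) -> P (rgt k) -> P k.+2) -> forall v, P v.
Proof.
move=> P0 P1 PS v; have [n] := ubnP v; elim: n v => // n IH [|[|k]] // kn.
by apply: PS; apply: IH; [apply: leq_trans (lft_lt a k) _ | apply: leq_trans (rgt_lt a k) _].
Qed.

Lemma mem_descents v g : (v < N.+2)%N -> (g \in descents v) = walk v g.
Proof.
elim/vertex_ind: v g => [||k IHl IHr] g kN; try by rewrite inE; case: g => //= e g;
  rewrite /down /=; case: e => [[[|[|u]]]].
have lN : (lft k < N.+2)%N := ltn_trans (lft_lt a k) kN.
have rN : (rgt k < N.+2)%N := ltn_trans (rgt_lt a k) kN.
rewrite descentsS mem_cat; apply/orP/idP.
  case=> /mapP[g' hg' ->] /=; rewrite /down /= !inordK //= eqxx !inE eqxx ?orbT /=.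
    by rewrite -IHl.
  by rewrite -IHr.
case: g => // -[u v] g /and3P[/eqP /= uE]; rewrite /down /= uE /= !inE => /orP[]/eqP vE wg.
  left; apply/mapP; exists g; first by rewrite IHl // -vE.
  by congr ((_, _) :: _); apply/val_inj; rewrite /= inordK // -vE.
right; apply/mapP; exists g; first by rewrite IHr // -vE.
by congr ((_, _) :: _); apply/val_inj; rewrite /= inordK // -vE.
Qed.

Lemma uniq_descents v : (v < N.+2)%N -> uniq (descents v).
Proof.
elim/vertex_ind: v => // k IHl IHr kN.
have lN : (lft k < N.+2)%N := ltn_trans (lft_lt a k) kN.
have rN : (rgt k < N.+2)%N := ltn_trans (rgt_lt a k) kN.
have inj (e : dedge a) : injective (cons e) by move=> g g' [].
rewrite descentsS cat_uniq !map_inj_uniq // IHl // IHr // andbT /=.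
apply/hasPn => g /mapP[g' _ ->]; apply/mapP => -[g'' _ [/(congr1 val)]] /=.
by rewrite !inordK // => /eqP; rewrite eq_sym (negPf (lft_neq_rgt a k)).
Qed.

Section Sum.

Variables (R : comNzRingType) (w : nat -> R).

Definition path_sum : nat -> R :=
  at_vertex a (fun k x y => x + \prod_((rgt k).-1 <= i < k.+1) w i * y) (1, 1).

Lemma path_sumS k : path_sum k.+2 =
  path_sum (lft k) + \prod_((rgt k).-1 <= i < k.+1) w i * path_sum (rgt k).
Proof. exact: at_vertexS. Qed.

(** A first step to the left end adds no triangle to the left part.  A first step
    to the right end adds the triangles [rgt k - 1, ..., k], and these are
    disjoint from the ones beside the later steps, which start at [rgt k] or
    below. *)
Lemma sum_descents v : (v < N.+2)%N ->
  \sum_(g <- descents v) \prod_(i < N | left_of g i) w i = path_sum v.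
Proof.
elim/vertex_ind: v => [||k IHl IHr] kN; try by rewrite big_seq1 big_pred0.
have lN : (lft k < N.+2)%N := ltn_trans (lft_lt a k) kN.
have rN : (rgt k < N.+2)%N := ltn_trans (rgt_lt a k) kN.
rewrite path_sumS -IHl // -IHr // descentsS big_cat !big_map /=; congr (_ + _).
  apply: eq_bigr => g _; apply: eq_bigl => i; rewrite /left_of /= /right_step /=.
  by rewrite !inordK // (negPf (lft_neq_rgt a k)) andbF.
rewrite mulr_sumr [LHS]big_seq [RHS]big_seq; apply: eq_bigr => g.
rewrite mem_descents // => wg.
rewrite (bigID (fun i : 'I_N => (rgt k < i.+2 <= k.+2)%N)) /=; congr (_ * _).
  transitivity (\prod_(i < N | ((rgt k).-1 <= i < k.+1)%N) w i).
    apply: eq_bigl => i; rewrite /left_of /= /covers /right_step /= !inordK // eqxx andbT.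
    by case: has; have := rgt_gt0 a k; lia.
  rewrite -(big_ord_widen_cond N (fun i => (rgt k).-1 <= i)%N w) //.
  by rewrite big_geq_mkord.
apply: eq_bigl => i; rewrite /left_of /= /covers /right_step /= !inordK // eqxx andbT.
case: hasP => [[e eg /andP[/andP[e2 e1] _]]|_].
  have := leq_trans e1 (walk_start_le wg eg).
  by move=> h; rewrite orbT ltnNge h.
by rewrite orbF andbN.
Qed.

Lemma sum_paths p q (f : seq (dedge a) -> R) :
  (0 < N)%N -> label a N.+1 = (p, q) ->
  \sum_(g in paths a p q) f g = \sum_(g <- descents N.+1) f g.
Proof.
move=> N0 top.
transitivity (
  \sum_(g <- map (fun g : {bseq N.+2 of dedge a} => g : seq _) (enum (paths a p q))) f g).
  by rewrite big_map big_enum.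
apply/perm_big/uniq_perm; last move=> g.
- by rewrite (map_inj_uniq val_inj) enum_uniq.
- exact: uniq_descents.
rewrite mem_descents // -(is_path_walk g N0 top); apply/mapP/idP => [[h]|hg].
  by rewrite mem_enum inE => hh ->.
by exists (Bseq (size_path hg)); rewrite ?mem_enum ?inE.
Qed.

Lemma path_sum_top p q : (0 < N)%N -> label a N.+1 = (p, q) ->
  \sum_(g in paths a p q) \prod_(i in left_part g) w i = path_sum N.+1.
Proof.
move=> N0 top.
rewrite (sum_paths (fun g => \prod_(i in left_part g) w i) N0 top) -sum_descents //.
rewrite [LHS]big_seq [RHS]big_seq; apply: eq_bigr => g.
rewrite mem_descents // => wg.
by apply: eq_bigl => i; rewrite left_partE // inE.
Qed.

End Sum.
End PathSum.

(** * The exchange relation for the weighted path sums *)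

Section Weights.

Variable a : seq nat.
Local Notation lft := (lft a).
Local Notation rgt := (rgt a).
Local Notation right := (is_right a).

Variables (F : fieldType) (x y : nat -> F).
Hypothesis x_neq0 : forall i, x i != 0.

(** The numerators and denominators of the weights, for arbitrary sequences [x],
    [y] indexed by all natural numbers, so that products over ranges can be
    split freely. *)
Definition num_mon (i : nat) : F :=
  y i * match i with
  | 0 => if right 0 then x 1 else 1
  | j.+1 => match right j.+1, right j with
            | true, true => x j.+2
            | true, false => x j * x j.+2
            | false, true => 1
            | false, false => x j
            end
  end.

Definition den_mon (i : nat) : F :=
  match i with
  | 0 => if right 0 then 1 else x 1
  | j.+1 => match right j.+1, right j with
            | true, true => x j
            | true, false => 1
            | false, true => x j * x j.+2
            | false, false => x j.+2
            end
  end.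

Lemma den_mon_neq0 i : den_mon i != 0.
Proof.
case: i => [|j] /=; first by case: (right 0); rewrite ?oner_neq0.
by case: (right j.+1); case: (right j); rewrite ?mulf_neq0 ?oner_neq0.
Qed.

(** Since the vertex [lft k] was created, only right triangles have been added
    below triangle [k].  The denominator of a right triangle [i] after a right
    one is [x (i - 1)], so the product telescopes to [1 / x k], up to the factor
    [x k.+1] contributed by triangle [k] when it is a left one. *)
Lemma prod_den k : \prod_((lft k).-1 <= i < k.+1) (den_mon i / x i) =
  (if right k then 1 else x k.+1) / x k.
Proof.
elim: k => [|k IH]; first by rewrite big_nat1.
have lk : ((lft k).-1 <= k.+1)%N by have := lft_lt a k; lia.
rewrite lftS /=; case E: (right k); last first.
  by rewrite big_nat1 /= E; case: right.
rewrite (big_nat_recr k.+1) //= IH E mul1r; case: right.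
  by rewrite mulKf ?x_neq0 // mul1r.
by rewrite -(mulrA (x k)) mulKf ?x_neq0.
Qed.

Lemma prod_num k : \prod_((rgt k).-1 <= i < k.+1) (num_mon i / x i) =
  \prod_((rgt k).-1 <= i < k.+1) y i * (if right k then x k.+1 else 1) / x k.
Proof.
elim: k => [|k IH]; first by rewrite !big_nat1.
have rk : ((rgt k).-1 <= k.+1)%N by have := rgt_lt a k; lia.
rewrite rgtS /=; case E: (right k).
  by rewrite 2!big_nat1 /num_mon /= E; case: right.
rewrite !(big_nat_recr k.+1) //= IH E mulr1 /num_mon /= E -!mulrA; congr (_ * _).
rewrite mulrCA; congr (_ * _); case: right.
  by rewrite !mulrA mulVf ?x_neq0 ?mul1r.
by rewrite !mulrA mulVf ?x_neq0 ?mul1r.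
Qed.

(** The normalized path sum: the cluster variable that the mutations
    create at index [v - 2].  In the surface model of type A this is the variable of
    the arc crossing the diagonals [0, ..., v - 2]. *)
Definition arc_var (v : nat) : F :=
  \prod_(0 <= i < v.-1) (den_mon i / x i) * path_sum a (fun i => num_mon i / den_mon i) v.

Lemma arc_var_le1 v : (v <= 1)%N -> arc_var v = 1.
Proof. by case: v => [|[|]] // _; rewrite /arc_var big_nil mul1r. Qed.

Lemma arc_varS k : arc_var k.+2 =
  ((if right k then 1 else x k.+1) * arc_var (lft k) +
   \prod_((rgt k).-1 <= i < k.+1) y i * (if right k then x k.+1 else 1) *
     arc_var (rgt k)) / x k.
Proof.
have lk : ((lft k).-1 <= k.+1)%N by have := lft_lt a k; lia.
have rk : ((rgt k).-1 <= k.+1)%N by have := rgt_lt a k; lia.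
rewrite {1}/arc_var path_sumS mulrDr mulrDl [_.-1]/=; congr (_ + _).
  rewrite (big_cat_nat _ lk) //= prod_den /arc_var.
  by rewrite -!mulrA mulrCA (mulrC (x k)^-1).
rewrite mulrAC -prod_num /arc_var (big_cat_nat _ rk) //= [RHS]mulrCA -!mulrA; congr (_ * _).
rewrite !mulrA; congr (_ * _); rewrite -big_split /=; apply: eq_bigr => i _.
by rewrite mulrC mulrA divfK ?den_mon_neq0.
Qed.

End Weights.

(** * Mutating at the vertices in order *)

Section Mutations.

Variable a : seq nat.
Local Notation N := (ntri a).
Local Notation lft := (lft a).
Local Notation rgt := (rgt a).
Local Notation right := (is_right a).

Lemma varx_neq0 (i : 'I_N) : varx i != 0.
Proof.
rewrite /varx tofrac_eq0; apply: contraNneq (oner_neq0 rat) => X0.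
by rewrite -[1]/(true%:R) -(eqxx (lshift N i)) -mcoeffXU X0 mcoeff0.
Qed.

Lemma xext_neq0 i : xext a i != 0.
Proof. by rewrite /xext; case: insub => [j|]; rewrite ?varx_neq0 ?oner_neq0. Qed.

Lemma xextE (i : 'I_N) : xext a i = varx i.
Proof. by rewrite /xext valK. Qed.

Definition yext (i : nat) : ratfun N := if insub i is Some j then vary j else 1.

Lemma yextE (i : 'I_N) : yext i = vary i.
Proof. by rewrite /yext valK. Qed.

Local Notation arcv := (arc_var a (xext a) yext).

(** The entry of the initial exchange matrix in row [i.+1] and column [i]. *)
Definition orient (i : nat) : int := if right i then 1 else -1.

Lemma quiver0E (i j : 'I_N) : quiver_mx (@quiver0 a) i j =
  ((i : nat) == j.+1)%:R * orient j - ((j : nat) == i.+1)%:R * orient i.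
Proof.
rewrite mxE /quiver0 /orient.
by case: right; case: right; case: eqP; case: eqP.
Qed.

(** What is known once the vertices before [k] have been mutated.  The
    columns and coefficients from [k] on determine, together with the cluster, the
    new variables in all the mutations that remain.  The coefficient at [k] is
    the product of [y_i] over the triangles between the creation of [rgt k] and
    the apex [k.+2], written as a row of exponents. *)
Record mutated (k : nat) (s : seed N) : Prop := Mutated {
  mutated_cluster : forall j : 'I_N,
    tnth (cluster s) j = if (j < k)%N then arcv j.+2 else varx j;
  mutated_coeffs : forall j : 'I_N, (k <= j)%N ->
    tnth (coeffs s) j =
    \row_i ((if (j : nat) == k then (rgt k).-1 else (j : nat)) <= i <= j)%N%:R;
  mutated_exmat : forall i j : 'I_N, (k <= j)%N ->
    exmat s i j =
    if (i < k)%N then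
      if (j : nat) == k then (i.+2 == rgt k)%:R - (i.+2 == lft k)%:R else 0
    else quiver_mx (@quiver0 a) i j }.

Lemma mutated0 : mutated 0 (initial_seed (@quiver0 a)).
Proof.
split=> [j|j _|i j _] /=; rewrite ?tnth_mktuple //.
apply/rowP => i; rewrite !mxE eqxx -(inj_eq val_inj) /=.
have -> : (if (j : nat) == 0%N then (rgt 0).-1 else j) = j :> nat by case: eqP => [->|].
by rewrite eqn_leq andbC.
Qed.

(** The ends [0] and [1] of the bottom edge have no cluster variable; they
    correspond to boundary segments, of value [1]. *)
Lemma prod_if_vertex (k : 'I_N) v : (v < k.+2)%N ->
  \prod_(i < N) (if i.+2 == v then arcv v else 1) = arcv v.
Proof.
case: v => [|[|m]]; try by move=> _; rewrite big1 // arc_var_le1.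
rewrite !ltnS => mk; have mN := ltn_trans mk (ltn_ord k).
rewrite (bigD1 (Ordinal mN)) //= eqxx big1 ?mulr1 // => i.
by rewrite -(inj_eq val_inj) /= !eqSS => /negPf ->.
Qed.

Lemma prod_if_next k b :
  \prod_(i < N) (if ((i : nat) == k.+1) && b then xext a k.+1 else 1) =
  if b then xext a k.+1 else 1.
Proof.
case: b; last by rewrite big1 // => i; rewrite andbF.
have [kN|kN] := ltnP k.+1 N.
  rewrite (bigD1 (Ordinal kN)) //= eqxx big1 ?mulr1 // => i.
  by rewrite -(inj_eq val_inj) /= andbT => /negPf ->.
rewrite /xext insubF; last by rewrite ltnNge kN.
by rewrite big1 // => i _; case: ifP.
Qed.

Lemma trop_val0 : trop_val (0 : trop N) = 1.
Proof. by rewrite /trop_val big1 // => j _; rewrite mxE expr0z. Qed.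

Section Step.

Variables (k : 'I_N) (s : seed N).
Hypothesis ms : mutated k s.
Local Notation X := (cluster s).
Local Notation B := (exmat s).
Local Notation u := (tnth (coeffs s) k).

Lemma coeffE : u = \row_i ((rgt k).-1 <= i <= k)%N%:R.
Proof. by rewrite (mutated_coeffs ms) // eqxx. Qed.

(** The exponents of [u] are nonnegative, so no denominator appears in the
    exchange relation. *)
Lemma coeff_oplus1 : trop_oplus u (trop_one N) = 0.
Proof. by rewrite coeffE; apply/rowP => i; rewrite !mxE; case: (_ <= _ <= _)%N. Qed.

Lemma coeff_val : trop_val u = \prod_((rgt k).-1 <= i < k.+1) yext i.
Proof.
rewrite coeffE /trop_val (eq_bigr (fun j : 'I_N =>
  if ((rgt k).-1 <= j < k.+1)%N then yext j else 1)); last first.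
  by move=> j _; rewrite mxE ltnS yextE; case: ifP => _; rewrite ?expr1z ?expr0z.
rewrite -big_mkcond /= -(big_ord_widen_cond N (fun i => (rgt k).-1 <= i)%N yext) //.
by rewrite big_geq_mkord.
Qed.

Lemma exmat_col (i : 'I_N) : B i k =
  ((i < k) && (i.+2 == rgt k))%N%:R - ((i < k) && (i.+2 == lft k))%N%:R +
  ((i : nat) == k.+1)%:R * orient k.
Proof.
rewrite (mutated_exmat ms) // eqxx quiver0E; case: ltnP => ik /=.
  by rewrite (ltn_eqF (leqW ik)) mul0r addr0.
by rewrite subrr add0r (ltn_eqF (ik : k < i.+1)%N) mul0r subr0.
Qed.

Lemma prod_neg : \prod_i tnth X i ^ pos (- B i k) =
  (if right k then 1 else xext a k.+1) * arcv (lft k).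
Proof.
rewrite mulrC -(prod_if_vertex (lft_lt a k)).
transitivity (\prod_(i < N) (if i.+2 == lft k then arcv (lft k) else 1) *
  \prod_(i < N) (if ((i : nat) == k.+1) && ~~ right k then xext a k.+1 else 1)).
  rewrite -big_split; apply: eq_bigr => i _ /=.
  rewrite exmat_col (mutated_cluster ms) /orient /pos.
  have lk := lft_lt a k; have lr := lft_neq_rgt a k.
  case: (ltnP i k) => ik /=.
    rewrite (ltn_eqF (ltnW (ik : i.+1 < k.+1)%N)) /= mul0r addr0 mulr1.
    have [E|_] := eqVneq i.+2 (lft k).
      by rewrite E (negPf lr) expr1z.
    by case: eqP => _; apply: expr0z.
  rewrite (gtn_eqF (leq_trans lk _)) // mul1r.
  have [E|_] := eqVneq (i : nat) k.+1; last by rewrite mul0r; apply: expr0z.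
  by case: right; rewrite /= ?(expr0z, expr1z) // -xextE E.
by rewrite prod_if_next; case: right.
Qed.

Lemma prod_pos : \prod_i tnth X i ^ pos (B i k) =
  (if right k then xext a k.+1 else 1) * arcv (rgt k).
Proof.
rewrite mulrC -(prod_if_vertex (rgt_lt a k)).
transitivity (\prod_(i < N) (if i.+2 == rgt k then arcv (rgt k) else 1) *
  \prod_(i < N) (if ((i : nat) == k.+1) && right k then xext a k.+1 else 1)).
  rewrite -big_split; apply: eq_bigr => i _ /=.
  rewrite exmat_col (mutated_cluster ms) /orient /pos.
  have rk := rgt_lt a k; have lr := lft_neq_rgt a k.
  case: (ltnP i k) => ik /=.
    rewrite (ltn_eqF (ltnW (ik : i.+1 < k.+1)%N)) /= mul0r addr0 mulr1.
    have [E|_] := eqVneq i.+2 (rgt k).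
      by rewrite E eq_sym (negPf lr) expr1z.
    by case: eqP => _; apply: expr0z.
  rewrite (gtn_eqF (leq_trans rk _)) // mul1r.
  have [E|_] := eqVneq (i : nat) k.+1; last by rewrite mul0r; apply: expr0z.
  by case: right; rewrite /= ?(expr0z, expr1z) // -xextE E.
by rewrite prod_if_next.
Qed.

(** Mutation at [k] reverses the arrow between [k] and [k.+1], making vertex [k]
    the new end of the next base; composing it with the arrows at [k] transfers
    to column [k.+1] the entry of the end that stays, [lft k] if triangle [k] is
    right and [rgt k] if it is left.  The coefficient at [k] is multiplied into
    the next one exactly when the right end stays. *)
Lemma mutatedS : mutated k.+1 (mutate s k).
Proof.
split=> [j|j kj|i j kj] /=.
- rewrite tnth_mktuple; have [->|jk] := eqVneq j k; last first.
    rewrite (mutated_cluster ms) (ltnS j) (leq_eqVlt j k).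
    by rewrite [_ == _ :> nat](negPf jk).
  rewrite leqnn coeff_oplus1 trop_val0 mul1r coeff_val prod_neg prod_pos.
  by rewrite (mutated_cluster ms) ltnn -xextE (arc_varS a yext xext_neq0) mulrA.
- rewrite tnth_mktuple coeff_oplus1 scaler0 addr0 ifN; last first.
    by apply: contraTneq kj => ->; rewrite ltnn.
  rewrite coeffE !(mutated_coeffs ms) ?(ltnW kj) //; apply/rowP => i; rewrite !mxE.
  rewrite (mutated_exmat ms) ?(ltnW kj) // ltnn quiver0E /orient /pos.
  rewrite (gtn_eqF kj) (ltn_eqF (leqW kj)) mul0r add0r rgtS.
  have [jk|_] := eqVneq (j : nat) k.+1.
    rewrite mul1r; have := rgt_lt a k; have := rgt_gt0 a k.
    rewrite jk; case: right => /=; rewrite ?mul0r ?addr0 ?mul1r //.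
    by lia.
  by rewrite mul0r oppr0 mul0r addr0.
rewrite mxE; have jk : (j == k) = false by apply: gtn_eqF.
rewrite jk orbF; have [->|ik] := eqVneq i k.
  rewrite leqnn (mutated_exmat ms) ?(ltnW kj) // ltnn quiver0E lftS rgtS /orient.
  rewrite (ltn_eqF (leqW kj)) mul0r add0r opprK.
  have := rgt_lt a k; have := lft_lt a k.
  case: (_ == k.+1); last by rewrite mul0r.
  rewrite mul1r; case: right => lk rk; rewrite eqxx.
    by rewrite (gtn_eqF lk) subr0.
  by rewrite (gtn_eqF rk) sub0r.
have Bkj : B k j = - (((j : nat) == k.+1)%:R * orient k).
  by rewrite (mutated_exmat ms) ?(ltnW kj) // ltnn quiver0E (ltn_eqF (leqW kj)) mul0r add0r.
rewrite Bkj (mutated_exmat ms) ?(ltnW kj) // (gtn_eqF kj) exmat_col.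
have ikE : (i < k.+1)%N = (i < k)%N.
  by rewrite ltnS leq_eqVlt; move/negPf: ik; rewrite -(inj_eq val_inj) /= => ->.
rewrite ikE; case: (ltnP i k) => ik'; last first.
  rewrite /= subrr add0r; case: eqP => _; last by rewrite mul0r sgr0 mul0r addr0.
  case: eqP => _; rewrite ?mul0r ?oppr0 ?mulr0 /pos ?maxxx ?mulr0 ?addr0 //.
  by rewrite /orient; case: right; rewrite addr0.
rewrite (ltn_eqF (ltnW (ik' : i.+1 < k.+1)%N)) mul0r addr0 add0r /=.
have [_|_] := eqVneq (j : nat) k.+1; last by rewrite mul0r oppr0 mulr0 /pos maxxx mulr0.
have i2 : (i.+2 == k.+2) = false by rewrite !eqSS ltn_eqF.
rewrite mul1r lftS rgtS /orient.
have [E|/negPf ir] := eqVneq i.+2 (rgt k).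
  have rl : (rgt k == lft k) = false by rewrite eq_sym (negPf (lft_neq_rgt a k)).
  by rewrite E rl; case: right; rewrite ?eqxx ?rl (ltn_eqF (rgt_lt a k)).
by case: (right k); rewrite ?i2 ?ir; case: eqP.
Qed.

End Step.

Lemma mutated_foldl k : (k <= N)%N ->
  mutated k (foldl (@mutate N) (initial_seed (@quiver0 a)) (take k (enum 'I_N))).
Proof.
elim: k => [|k IH] kN; first by rewrite take0; apply: mutated0.
rewrite (take_nth (Ordinal kN)) ?size_enum_ord // foldl_rcons.
have -> : nth (Ordinal kN) (enum 'I_N) k = Ordinal kN.
  by apply/val_inj; rewrite /= nth_enum_ord.
exact: (@mutatedS (Ordinal kN) _ (IH (ltnW kN))).
Qed.

Lemma cluster_varE : (0 < N)%N -> cluster_var a = arcv N.+1.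
Proof.
move=> N0; have N1 : (N.-1 < N)%N by rewrite ltn_predL.
rewrite /cluster_var -[N.-1]/(nat_of_ord (Ordinal N1)) -tnth_nth.
have := mutated_cluster (mutated_foldl (leqnn N)) (Ordinal N1).
by rewrite take_oversize ?size_enum_ord // => ->; rewrite /= N1 prednK.
Qed.

Lemma wt_denE (i : 'I_N) : wt_den i = den_mon a (xext a) i.
Proof. by []. Qed.

Lemma wt_triE (i : 'I_N) : wt_tri i = num_mon a (xext a) yext i / den_mon a (xext a) i.
Proof. by rewrite /wt_tri /wt_num /num_mon yextE. Qed.

End Mutations.

(** * Evaluation at x = 1 *)

Section FPolynomial.

Variable N : nat.
Implicit Types (X Y : ratfun N) (F G : {mpoly rat[N]}) (P Q : {mpoly rat[N + N]}).

Lemma subst_x1M P Q : subst_x1 (P * Q) = subst_x1 P * subst_x1 Q.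
Proof. by rewrite /subst_x1 rmorphM. Qed.

Lemma subst_x1D P Q : subst_x1 (P + Q) = subst_x1 P + subst_x1 Q.
Proof. by rewrite /subst_x1 rmorphD. Qed.

Lemma subst_x1_1 : subst_x1 (1 : {mpoly rat[N + N]}) = 1.
Proof. by rewrite /subst_x1 rmorph1. Qed.

Lemma tofrac_subst_neq0 P : subst_x1 P != 0 -> FracField.tofrac P != 0.
Proof.
by apply: contraNneq => /eqP; rewrite tofrac_eq0 => /eqP ->; rewrite /subst_x1 comp_mpoly0.
Qed.

Lemma Fpoly_tofrac P : is_Fpolynomial (FracField.tofrac P) (subst_x1 P).
Proof.
by exists P, 1; rewrite rmorph1 divr1 subst_x1_1 mulr1 oner_neq0.
Qed.

Lemma Fpoly1 : is_Fpolynomial (1 : ratfun N) 1.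
Proof. by have := Fpoly_tofrac 1; rewrite subst_x1_1 rmorph1. Qed.

Lemma Fpoly0 : is_Fpolynomial (0 : ratfun N) 0.
Proof. by have := Fpoly_tofrac 0; rewrite /subst_x1 !rmorph0. Qed.

Lemma FpolyM X Y F G :
  is_Fpolynomial X F -> is_Fpolynomial Y G -> is_Fpolynomial (X * Y) (F * G).
Proof.
case=> P [Q [-> Q0 PE]] [P' [Q' [-> Q0' PE']]]; exists (P * P'), (Q * Q').
by rewrite !rmorphM /= mulf_div !subst_x1M mulf_neq0 // PE PE' mulrACA.
Qed.

Lemma Fpoly_mul1 X Y F :
  is_Fpolynomial X F -> is_Fpolynomial Y 1 -> is_Fpolynomial (X * Y) F.
Proof. by move=> hX hY; rewrite -[F]mulr1; apply: FpolyM. Qed.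

Lemma FpolyD X Y F G :
  is_Fpolynomial X F -> is_Fpolynomial Y G -> is_Fpolynomial (X + Y) (F + G).
Proof.
case=> P [Q [-> Q0 PE]] [P' [Q' [-> Q0' PE']]]; exists (P * Q' + P' * Q), (Q * Q').
rewrite rmorphD !rmorphM /= addf_div ?tofrac_subst_neq0 // subst_x1D !subst_x1M mulf_neq0 //.
split=> //; rewrite PE PE'; ring.
Qed.

Lemma FpolyV X : is_Fpolynomial X 1 -> is_Fpolynomial X^-1 1.
Proof.
case=> P [Q [-> Q0 PE]]; exists Q, P.
by rewrite invf_div mul1r PE mul1r.
Qed.

Lemma Fpoly_varx (i : 'I_N) : is_Fpolynomial (varx i) 1.
Proof.
have := Fpoly_tofrac 'X_(lshift N i); congr is_Fpolynomial.
by rewrite /subst_x1 comp_mpolyXU -tnth_nth tnth_mktuple (unsplitK (inl i)).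
Qed.

Lemma Fpoly_vary (i : 'I_N) : is_Fpolynomial (vary i) 'X_i.
Proof.
have := Fpoly_tofrac 'X_(rshift N i); congr is_Fpolynomial.
by rewrite /subst_x1 comp_mpolyXU -tnth_nth tnth_mktuple (unsplitK (inr i)).
Qed.

Lemma Fpoly_prod (I : Type) (r : seq I) (p : pred I)
    (X : I -> ratfun N) (F : I -> {mpoly rat[N]}) :
  (forall i, p i -> is_Fpolynomial (X i) (F i)) ->
  is_Fpolynomial (\prod_(i <- r | p i) X i) (\prod_(i <- r | p i) F i).
Proof. by move=> h; apply: big_ind2 => //; [apply: Fpoly1 | move=> *; apply: FpolyM]. Qed.

Lemma Fpoly_prod1 (I : Type) (r : seq I) (p : pred I) (X : I -> ratfun N) :
  (forall i, p i -> is_Fpolynomial (X i) 1) ->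
  is_Fpolynomial (\prod_(i <- r | p i) X i) 1.
Proof.
move=> h; elim/big_ind: _ => //; first exact: Fpoly1.
by move=> Y Z; apply: Fpoly_mul1.
Qed.

Lemma Fpoly_sum (I : Type) (r : seq I) (p : pred I)
    (X : I -> ratfun N) (F : I -> {mpoly rat[N]}) :
  (forall i, p i -> is_Fpolynomial (X i) (F i)) ->
  is_Fpolynomial (\sum_(i <- r | p i) X i) (\sum_(i <- r | p i) F i).
Proof. by move=> h; apply: big_ind2 => //; [apply: Fpoly0 | move=> *; apply: FpolyD]. Qed.

End FPolynomial.

Section Weights1.
Variable a : seq nat.
Local Notation N := (ntri a).

Lemma Fpoly_xext i : is_Fpolynomial (xext a i) 1.
Proof. by rewrite /xext; case: insub => [j|]; [apply: Fpoly_varx | apply: Fpoly1]. Qed.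

Lemma Fpoly_wt_den (i : 'I_N) : is_Fpolynomial (wt_den i) 1.
Proof.
rewrite /wt_den; case: (nat_of_ord i) => [|j]; first case: (is_right a 0);
  last (case: (is_right a j.+1); case: (is_right a j));
  by do ?apply: Fpoly_mul1; do ?apply: Fpoly_xext; apply: Fpoly1.
Qed.

Lemma Fpoly_wt_tri (i : 'I_N) : is_Fpolynomial (wt_tri i) 'X_i.
Proof.
apply: Fpoly_mul1; last exact/FpolyV/Fpoly_wt_den.
apply: Fpoly_mul1; first exact: Fpoly_vary.
case: (nat_of_ord i) => [|j]; first case: (is_right a 0);
  last (case: (is_right a j.+1); case: (is_right a j));
  by do ?apply: Fpoly_mul1; do ?apply: Fpoly_xext; apply: Fpoly1.
Qed.

End Weights1.

Theorem theorem3p3 (p q : nat) (a : seq nat) :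
  coprime p q -> (0 < p < q)%N -> is_expansion a p q ->
  cluster_var a =
    (\prod_(i < ntri a) wt_den i) / (\prod_(i < ntri a) varx i)
      * \sum_(g in paths a p q) wt g
  /\
  is_Fpolynomial (cluster_var a)
    (\sum_(g in paths a p q) \prod_(i in left_part g) 'X_i).
Proof.
move=> cpq pq exp; have [N0 top] := label_top cpq pq exp.
set D := _ / _.
have XE : cluster_var a = D * \sum_(g in paths a p q) wt g.
  rewrite cluster_varE // /arc_var big_mkord; congr (_ * _).
    rewrite /D -prodf_div; apply: eq_bigr => i _.
    by rewrite wt_denE xextE.
  rewrite -(path_sum_top _ N0 top); apply: eq_bigr => g _.
  by apply: eq_bigr => i _; rewrite wt_triE.
split=> //; rewrite XE mulrC; apply: Fpoly_mul1.
  by apply: Fpoly_sum => g _; apply: Fpoly_prod => i _; apply: Fpoly_wt_tri.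
apply: Fpoly_mul1; last apply: FpolyV; apply: Fpoly_prod1 => i _.
  exact: Fpoly_wt_den.
exact: Fpoly_varx.
Qed.
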